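(* Let $\alpha\in\mathbb Z$ and let $\mathrm{tr}(P_2)$ be the complex of abelian groups obtained from the trace of the second projector. Then, with integer coefficients, $H_0(\mathrm{tr}(P_2))= q^{-2}\mathbb Z\oplus q^0\mathbb Z$ and $H_1(\mathrm{tr}(P_2))=0$ for every $\alpha$; and for every $k>0$: $$H_{2k}(\mathrm{tr}(P_2))=\begin{cases} q^{4k-2}\mathbb Z & \alpha=0\\ 0&\alpha\ne 0,\end{cases}\qquad H_{2k+1}(\mathrm{tr}(P_2))=\begin{cases} q^{4k+2}\mathbb Z\oplus q^{4k}\mathbb Z/2 & \alpha=0\\ q^{4k+2}\mathbb Z/(2\alpha)\oplus q^{4k}\mathbb Z/2&\alpha\neq 0.\end{cases}$$ In particular, for $\alpha=0$ and rational coefficients, $H_0=q^{-2}\mathbb Q\oplus q^0\mathbb Q$, $H_1=0$, $H_{2k}=q^{4k-2}\mathbb Q$ and $H_{2k+1}=q^{4k+2}\mathbb Q$ for $k>0$.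
   Context: Let $A=\mathbb Z[x]/(x^2-\alpha)$, with $1$ placed in $q$-degree $+1$ and $x$ in $q$-degree $-1$ (this is the module $\mathrm{Hom}(\emptyset,\bigcirc)$ of the circle in Bar-Natan's dotted cobordism category with relations: sphere $=0$, once-dotted sphere $=1$, twice-dotted sphere $=0$, thrice-dotted sphere $=\alpha$, and neck cutting: a cylinder equals the sum of its two cappings carrying one dot on either disc; $1$ is the undotted disc, $x$ the dotted disc). Disjoint circles correspond to tensor products over $\mathbb Z$; a merging saddle induces multiplication, a dot induces multiplication by $x$; $q^j$ shifts $q$-degree by $j$. The second projector is the complex $P_2=(C_*,d_* )$ with $C_0=1$ (two vertical strands) and $C_k=q^{2k-1}e_1$ for $k>0$, where $e_1$ is the cup-cap Temperley-Lieb diagram on 2 strands; $d_0$ is the saddle, $d_k$ is (dot on top arc) $-$ (dot on bottom arc) for odd $k$ and (dot on top arc) $+$ (dot on bottom arc) for even $k\ge 2$. Its trace (closing the diagrams by connecting top points to the corresponding bottom points by parallel arcs) is the complex $$A\otimes A\xrightarrow{\ m\ } qA\xrightarrow{\ 0\ } q^3A\xrightarrow{\ 2x\ } q^5A\xrightarrow{\ 0\ }q^7A\xrightarrow{\ 2x\ }\cdots$$ with $A\otimes A$ in homological degree $0$ and $m$ the multiplication; differentials raise homological degree by one and $H_n$ is the homology in degree $n$. The notation $q^jM$ indicates the group $M$ generated in $q$-degree $j$. When $\alpha\neq0$ is an integer the $q$-grading is not strictly preserved by multiplication by $x$, and the powers of $q$ simply record the (leading) $q$-degrees of generators. *)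

(* Defs.v *)
From HB Require Import structures.
From mathcomp Require Import all_boot all_order all_algebra ring_quotient qpoly.
From mathcomp Require Import boolp.

Set Implicit Arguments.
Unset Strict Implicit.
Unset Printing Implicit Defensive.

Import Order.TTheory GRing.Theory Num.Theory.
Import Pdiv.CommonRing Pdiv.RingMonic.
Local Open Scope ring_scope.

(* An abelian group with q-degrees: [supported P g] says that [g] can be      *)
(* written as a combination of generators whose q-degrees all satisfy [P].    *)
(* With [P] a singleton these are the homogeneous elements of a degree; with  *)
(* [P] a half-line, the filtration by leading degree.                         *)
Record qgroup := QGroup {
  qsort :> zmodType;
  supported : pred int -> qsort -> Prop }.
Arguments supported : clear implicits.

Definition qzero : qgroup := @QGroup 'rV[int]_0 (fun _ _ => True).

(* The group [M], generated in q-degree [j]. *)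
Definition qat (j : int) (M : zmodType) : qgroup :=
  @QGroup M (fun P g => g != 0 -> P j).

(* The cyclic group Z/m, for |m| >= 2 only: ['Z_0] and ['Z_1] both denote Z/2. *)
Definition Zmod (m : int) : zmodType := 'Z_`|m|%N.

Definition qsum (G H : qgroup) : qgroup :=
  @QGroup (G * H)%type
    (fun P g => supported G P g.1 /\ supported H P g.2).

Definition qshift (j : int) (G : qgroup) : qgroup :=
  @QGroup G (fun P g => supported G (fun i => P (i + j)) g).

Definition graded_iso (G H : qgroup) : Prop :=
  exists f : {additive G -> H}, bijective f /\
    forall (j : int) (g : G),
      supported H (fun i => i == j) (f g) <-> supported G (fun i => i == j) g.

(* The leading part of an element is the one of lowest q-degree: all the maps *)
(* below preserve the decreasing filtration by q-degree at least [j].         *)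
Definition filtered_iso (G H : qgroup) : Prop :=
  exists f : {additive G -> H}, bijective f /\
    forall (j : int) (g : G),
      supported H (fun i => j <= i) (f g) <-> supported G (fun i => j <= i) g.

(* Isomorphism of groups with q-degrees when x^2 = alpha: the q-grading is    *)
(* preserved by the differentials only for alpha = 0, and otherwise only the  *)
(* leading q-degrees make sense.                                              *)
Definition qiso (alpha : int) (G H : qgroup) : Prop :=
  if alpha == 0 then graded_iso G H else filtered_iso G H.

Record qcomplex := QComplex {
  chain : nat -> qgroup;
  diff : forall n, {additive chain n -> chain n.+1};
  diff_diff : forall n (c : chain n), diff n.+1 (diff n c) = 0 }.

Section Homology.
Variables (C : qcomplex) (n : nat).

Definition is_cycle : pred (chain C n) := fun c => diff C n c == 0.

Fact is_cycle_zmod_closed : zmod_closed is_cycle.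
Proof.
split=> [|u v]; rewrite !unfold_in /is_cycle ?raddf0 // raddfB.
by move=> /eqP-> /eqP->; rewrite subr0.
Qed.
HB.instance Definition _ :=
  GRing.isZmodClosed.Build (chain C n) is_cycle is_cycle_zmod_closed.

Record cycle := Cycle { cycle_val :> chain C n; _ : is_cycle cycle_val }.
HB.instance Definition _ := [isSub for cycle_val].
HB.instance Definition _ := [Choice of cycle by <:].
HB.instance Definition _ := [SubChoice_isSubZmodule of cycle by <:].

End Homology.

Definition is_boundary_val (C : qcomplex) (n : nat) : chain C n -> bool :=
  match n with
  | 0 => fun c => c == 0
  | m.+1 => fun c => `[< exists b, diff C m b = c >]
  end.

Section HomologyQuotient.
Variables (C : qcomplex) (n : nat).

Definition is_boundary (z : cycle C n) : bool := is_boundary_val (z : chain C n).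

Fact is_boundary_zmod_closed : zmod_closed is_boundary.
Proof.
rewrite /is_boundary; case: n => [|m]; split.
- by rewrite unfold_in /= eqxx.
- move=> u v; rewrite !unfold_in /= => /eqP hu /eqP hv.
  by rewrite hu hv subr0.
- by rewrite unfold_in /=; apply/asboolP; exists 0; rewrite raddf0.
- move=> u v; rewrite !unfold_in /= => /asboolP[b hb] /asboolP[c hc].
  by apply/asboolP; exists (b - c); rewrite raddfB hb hc.
Qed.
HB.instance Definition _ :=
  GRing.isZmodClosed.Build (cycle C n) is_boundary is_boundary_zmod_closed.

Definition boundaries : zmodClosed (cycle C n) :=
  GRing.ZmodClosed.clone _ is_boundary _.

Definition homology : qgroup :=
  @QGroup (Quotient.quot boundaries)
    (fun P h => exists z : cycle C n,
       supported (chain C n) P z /\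
       (\pi_(Quotient.quot boundaries) z)%qT = h).

End HomologyQuotient.

Section Frobenius.
Variables (R : comNzRingType) (a : R).

(* A = R[x]/(x^2 - a), with x represented by ['qX] *)
Definition frobA := {poly %/ 'X^2 - a%:P}.

(* [{poly %/ h}] is a quotient by 'X unless h is monic of size at least 2. *)
Fact frobA_modulus : mk_monic ('X^2 - a%:P) = 'X^2 - a%:P.
Proof.
have sz : size ('X^2 - a%:P : {poly R}) = 3%N by rewrite size_XnsubC.
by rewrite /mk_monic sz /= monicE /lead_coef sz coefB coefXn coefC subr0 eqxx.
Qed.

(* q-degree of the basis element x^i (i = 0, 1) of A *)
Definition deg (i : nat) : int := 1 - 2 * i%:Z.

Definition qA : qgroup :=
  @QGroup frobA (fun P u => forall i : 'I_2, u`_i != 0 -> P (deg i)).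

(* A (x) A over R: the matrix M stands for \sum_(i, j) M i j x^i (x) x^j;    *)
(* its universal property is [tens_universal] below.                          *)
Definition tensA := 'M[R]_2.

Definition tens (u v : frobA) : tensA := \matrix_(i, j) (u`_i * v`_j).

Definition qAA : qgroup :=
  @QGroup tensA
    (fun P M => forall i j : 'I_2, M i j != 0 -> P (deg i + deg j)).

(* the merging saddle, see [mergeA_tens] *)
Definition mergeA (M : tensA) : frobA :=
  \sum_(i < 2) \sum_(j < 2) M i j *: ('qX ^+ i * 'qX ^+ j).

Definition dotA (u : frobA) : frobA := 'qX * u.

Fact mergeA_zmod_morphism : zmod_morphism mergeA.
Proof.
move=> M N; rewrite /mergeA -sumrB; apply: eq_bigr => i _.
by rewrite -sumrB; apply: eq_bigr => j _; rewrite !mxE scalerBl.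
Qed.
HB.instance Definition _ :=
  GRing.isZmodMorphism.Build tensA frobA mergeA mergeA_zmod_morphism.

Fact dotA_zmod_morphism : zmod_morphism dotA.
Proof. by move=> u v; rewrite /dotA mulrBr. Qed.
HB.instance Definition _ :=
  GRing.isZmodMorphism.Build frobA frobA dotA dotA_zmod_morphism.

Fact polyn_qX : ('qX : frobA) = 'X :> {poly R}.
Proof. by rewrite in_qpoly_small // frobA_modulus size_polyX size_XnsubC. Qed.

Lemma qX_sqr : 'qX * 'qX = a *: 1 :> frobA.
Proof.
have mon : ('X^2 - a%:P : {poly R}) \is monic by exact: monicXnsubC.
apply/val_inj; transitivity (a%:P : {poly R}); last by rewrite /= alg_polyC.
rewrite [LHS]poly_of_qpolyM polyn_qX frobA_modulus -expr2.
rewrite -[X in rmodp X _](subrK a%:P) rmodpD // rmodpp // add0r rmodp_small //.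
by rewrite size_XnsubC // ltnS (leq_trans (size_polyC_leq1 _)).
Qed.

Lemma frobA_coefD (u v : frobA) i : (u + v)`_i = u`_i + v`_i.
Proof. exact: coefD. Qed.

Lemma frobA_coefZ c (u : frobA) i : (c *: u)`_i = c * u`_i.
Proof. exact: coefZ. Qed.

Lemma frobA_coef1 i : (1 : frobA)`_i = (i == 0)%:R.
Proof. exact: coef1. Qed.

Lemma frobA_coefX i : ('qX : frobA)`_i = (i == 1)%:R.
Proof. by rewrite polyn_qX coefX. Qed.

Definition frobA_coefE := (frobA_coefD, frobA_coefZ, frobA_coef1, frobA_coefX).

Lemma frobA_basis (u : frobA) : u = \sum_(i < 2) u`_i *: 'qX ^+ i.
Proof.
rewrite !big_ord_recl big_ord0 addr0 expr0 expr1; apply/npolyP => k.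
have sz : (size u <= 2)%N.
  by apply: leq_trans (size_npoly u) _; rewrite frobA_modulus size_XnsubC.
rewrite !frobA_coefE.
case: k => [|[|k]] /=; rewrite ?mulr1 ?mulr0 ?addr0 ?add0r //.
by rewrite nth_default // (leq_trans sz).
Qed.

Lemma mergeA_tens (u v : frobA) : mergeA (tens u v) = u * v.
Proof.
rewrite [in RHS](frobA_basis u) [in RHS](frobA_basis v) mulr_suml.
apply: eq_bigr => i _; rewrite mulr_sumr; apply: eq_bigr => j _.
by rewrite !mxE -scalerAl -scalerAr scalerA.
Qed.

Lemma tens_universal (V : lmodType R) (f : frobA -> frobA -> V) :
    (forall u, linear (f u)) -> (forall v, linear (f^~ v)) ->
  exists! g : tensA -> V, linear g /\ forall u v, g (tens u v) = f u v.
Proof.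
move=> fl fr; pose e (i : 'I_2) : frobA := 'qX ^+ i.
pose g (M : tensA) := \sum_(i < 2) \sum_(j < 2) M i j *: f (e i) (e j).
have e_coef (i j : 'I_2) : (e i)`_j = (j == i)%:R :> R.
  rewrite -val_eqE; case: i => -[|[|//]] lti; rewrite /e [nat_of_ord _]/=.
    by rewrite expr0 frobA_coefE.
  by rewrite expr1 frobA_coefE.
have gl : linear g.
  move=> c M N; rewrite /g scaler_sumr -big_split; apply: eq_bigr => i _ /=.
  rewrite scaler_sumr -big_split; apply: eq_bigr => j _ /=.
  by rewrite !mxE scalerDl scalerA.
exists g; split=> [|h [hl ht]].
  split=> // u v; pose fL w := GRing.isLinear.Build R frobA V *:%R (f w) (fl w).
  pose FL w : {linear frobA -> V} := HB.pack (f w) (fL w).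
  pose fR w := GRing.isLinear.Build R frobA V *:%R (f^~ w) (fr w).
  pose FR w : {linear frobA -> V} := HB.pack (f^~ w) (fR w).
  rewrite -[RHS]/(FR v u) [in RHS](frobA_basis u) linear_sum.
  apply: eq_bigr => i _; rewrite linearZ /= -[f _ v]/(FL (e i) v).
  rewrite [in RHS](frobA_basis v) linear_sum scaler_sumr.
  by apply: eq_bigr => j _; rewrite linearZ /= !mxE scalerA.
apply/funext => M; pose hL := GRing.isLinear.Build R tensA V *:%R h hl.
pose H : {linear tensA -> V} := HB.pack h hL.
rewrite -[RHS]/(H M) [in RHS](matrix_sum_delta M) linear_sum.
apply: eq_bigr => i _; rewrite linear_sum; apply: eq_bigr => j _.
rewrite linearZ /= -ht; congr (_ *: h _); apply/matrixP => k l.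
by rewrite !mxE !e_coef -natrM mulnb.
Qed.

End Frobenius.

(* The diagrams of P_2: two vertical strands, and the cup-cap diagram e_1.    *)
Inductive tl2 := Strands | CupCap.

(* Formal Z-combinations of the dotted cobordisms occurring in P_2;           *)
(* [DotTop] (resp. [DotBottom]) is the identity cobordism of e_1 with one dot *)
(* on the sheet over the top (resp. bottom) arc.                              *)
Inductive dcob : tl2 -> tl2 -> Type :=
  | Saddle : dcob Strands CupCap
  | DotTop : dcob CupCap CupCap
  | DotBottom : dcob CupCap CupCap
  | CobAdd D E of dcob D E & dcob D E : dcob D E
  | CobOpp D E of dcob D E : dcob D E.

Definition P2_diagram (k : nat) : tl2 := if k is 0 then Strands else CupCap.

Definition P2_shift (k : nat) : int := if k is 0 then 0 else 2 * k%:Z - 1.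

Definition P2_diff (k : nat) : dcob (P2_diagram k) (P2_diagram k.+1) :=
  match k with
  | 0 => Saddle
  | k'.+1 => if odd k then CobAdd DotTop (CobOpp DotBottom)
             else CobAdd DotTop DotBottom
  end.

Section Trace.
Variables (R : comNzRingType) (a : R).

(* The closure of the two strands is a pair of circles.  The closure of e_1   *)
(* is a single circle, which contains both the top and the bottom arc, so     *)
(* that a dot on either arc acts as multiplication by x.                      *)
Definition tr_diagram (D : tl2) : qgroup :=
  match D with Strands => qAA R | CupCap => qA a end.

Fixpoint tr_cob D E (f : dcob D E) : {additive tr_diagram D -> tr_diagram E} :=
  match f in dcob D E return {additive tr_diagram D -> tr_diagram E} with
  | Saddle => @mergeA R a
  | DotTop => @dotA R a
  | DotBottom => @dotA R a
  | CobAdd _ _ f g => tr_cob f \+ tr_cob g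
  | CobOpp _ _ f => \- tr_cob f
  end.

Definition tr_P2_chain (k : nat) : qgroup :=
  qshift (P2_shift k) (tr_diagram (P2_diagram k)).

Definition tr_P2_diff (k : nat) : {additive tr_P2_chain k -> tr_P2_chain k.+1} :=
  tr_cob (P2_diff k).

Lemma tr_P2_diff0 (M : tensA R) : tr_P2_diff 0 M = mergeA a M.
Proof. by []. Qed.

Lemma tr_P2_diff_odd k (u : frobA a) : odd k.+1 -> tr_P2_diff k.+1 u = 0.
Proof. by rewrite /tr_P2_diff /P2_diff => -> /=; rewrite subrr. Qed.

Lemma tr_P2_diff_even k (u : frobA a) :
  ~~ odd k.+1 -> tr_P2_diff k.+1 u = 2 * 'qX * u.
Proof.
rewrite /tr_P2_diff /P2_diff => /negPf-> /=.
by rewrite -mulrA mulr_natl mulr2n.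
Qed.

Fact tr_P2_diff_diff k c : tr_P2_diff k.+1 (tr_P2_diff k c) = 0.
Proof.
case: k c => [|k] c; first exact: tr_P2_diff_odd.
case ok : (odd k.+1); first by rewrite (tr_P2_diff_odd c ok); exact: raddf0.
by apply: tr_P2_diff_odd; rewrite oddS ok.
Qed.

(* For R = int this is tr(P_2) with x^2 = a.  For R = rat and a an integer it *)
(* is tr(P_2) with rational coefficients; an additive map between rational    *)
(* vector spaces, such as its homology groups, is automatically Q-linear.     *)
Definition tr_P2 : qcomplex := QComplex tr_P2_diff_diff.

End Trace.

(* Main.v *)
Require Import Defs.
From HB Require Import structures.
From mathcomp Require Import all_boot all_order all_algebra ring_quotient generic_quotient.
From mathcomp Require Import boolp zify.

Set Implicit Arguments.
Unset Strict Implicit.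
Unset Printing Implicit Defensive.

Import Order.TTheory GRing.Theory Num.Theory.
Local Open Scope ring_scope.
Local Open Scope quotient_scope.

(* An element c0 + c1 x of A is a pair of coefficients, on which 2x acts by    *)
(* (c0, c1) |-> (2 alpha c1, 2 c0). Each homology group is then read off from  *)
(* a coordinate map on chains whose kernel on cycles is the boundaries. The    *)
(* q-degrees match because the coordinate map has a section by cycles which,   *)
(* like the map itself, respects supports; for alpha <> 0 this holds only for  *)
(* up-closed supports, since x (x) x - alpha (1 (x) 1) mixes q-degrees.        *)

(** In the closure of [e_1] the top and bottom arcs lie on the same circle, so the odd differentials
    cancel and the even ones become multiplication by 2x. The complex therefore splits beyond degree
    1 into pieces A -> A given by 2x, from degree 2k to degree 2k+1, while degrees 0 and 1 carry m.
    Since m is onto and followed by 0, H_1 vanishes, and H_0 is the kernel of m ([homology1],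
    [homology0]).

    As 2x sends 1 to 2x and x to 2 alpha, its cokernel is Z/(2 alpha) on 1 plus Z/2 on x
    ([homology_odd]); its kernel is spanned by x if alpha = 0 and is zero otherwise
    ([homology_even], [homology_even_acyclic]). These computations are made over a general ring, so
    that Z and Q are covered together; over Q the factor 2 is invertible and the torsion disappears
    ([homology_odd_unit]).

    The predicate [S] selects the sets of degrees to be respected, so that one notion of isomorphism
    serves both the graded and the filtered statement. *)

Definition supp_iso (S : pred int -> Prop) (G H : qgroup) : Prop :=
  exists f : {additive G -> H}, bijective f /\
    forall P g, S P -> supported H P (f g) <-> supported G P g.

(* The supports to be matched: up-closed sets of degrees suffice for the
   filtration, but all singletons are needed for the grading. *)
Definition admissible (R : nzRingType) (a : R) (P : pred int) : Prop :=
  a <> 0 -> {homo P : i j / i <= j >-> i ==> j}.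

Lemma supp_iso_graded (R : nzRingType) (G H : qgroup) :
  supp_iso (@admissible R 0) G H -> graded_iso G H.
Proof. by case=> f [fbij fS]; exists f; split=> // j g; apply: fS. Qed.

Lemma supp_iso_qiso (a : int) (G H : qgroup) :
  supp_iso (admissible a) G H -> qiso a G H.
Proof.
rewrite /qiso; case: eqP => [->|_]; first exact: supp_iso_graded.
case=> f [fbij fS]; exists f; split=> // j g; apply: fS => _ i k /= leik.
by apply/implyP => leji; apply: le_trans leji leik.
Qed.

(** * Reading off homology from a coordinate map with a section *)

Section HomologySuppIso.

Variables (C : qcomplex) (n : nat) (G : qgroup) (S : pred int -> Prop).
Variables (f : chain C n -> G) (s : G -> chain C n).
Hypothesis fB : zmod_morphism f.
Hypothesis s_cycle : forall g, diff C n (s g) = 0.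
Hypothesis sK : cancel s f.
Hypothesis f_eq0 : forall z, diff C n z = 0 -> f z = 0 <-> is_boundary_val z.
Hypothesis f_supp : forall P z, S P -> diff C n z = 0 ->
  supported (chain C n) P z -> supported G P (f z).
Hypothesis s_supp : forall P g, S P ->
  supported G P g -> supported (chain C n) P (s g).

Let cycleP (z : Defs.cycle C n) : diff C n (cycle_val z) = 0.
Proof. by case: z => z zC; apply/eqP. Qed.

Let quo := Quotient.quot (boundaries C n).

Let F (h : quo) : G := f (cycle_val (repr h)).

Let pi_eq (y z : Defs.cycle C n) :
  \pi_quo y = \pi_quo z <-> f (cycle_val y) = f (cycle_val z).
Proof.
have e : (y - z \in boundaries C n) <-> f (cycle_val y) = f (cycle_val z).
  rewrite -[_ \in _]/(is_boundary_val (cycle_val (y - z))).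
  rewrite -f_eq0 ?cycleP // -[cycle_val (y - z)]/(cycle_val y - cycle_val z) fB.
  by split=> [/subr0_eq|->]; rewrite ?subrr.
rewrite -e Quotient.idealrBE; split=> [->//|/eqP //].
Qed.

Let F_pi (z : Defs.cycle C n) : F (\pi_quo z) = f (cycle_val z).
Proof. by apply/pi_eq; rewrite reprK. Qed.

Let s_is_cycle g : is_cycle (s g). Proof. by apply/eqP. Qed.

(** On cycles [f] has kernel the boundaries, and [s] makes it onto, so it induces a bijection on
    homology. A class is supported in [P] when some representative is, and [s] provides such a
    representative. The section is a mere function: cyclic groups have no additive section to Z. *)
Lemma homology_supp_iso : supp_iso S (homology C n) G.
Proof.
have FB : zmod_morphism F.
  move=> h k; rewrite -[h]reprK -[k]reprK -raddfB !F_pi.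
  by rewrite -[cycle_val (_ - _)]/(cycle_val _ - cycle_val _) fB.
pose FA : {additive homology C n -> G} :=
  HB.pack (F : homology C n -> G) (GRing.isZmodMorphism.Build (homology C n) G F FB).
exists FA; split=> [|P h SP].
  exists (fun g => \pi_quo (Cycle (s_is_cycle g))) => [h|g] /=.
    by rewrite -[h in RHS]reprK; apply/pi_eq; rewrite /= sK.
  by rewrite F_pi /= sK.
split=> /= [suppF|[z [suppz <-]]]; last by rewrite F_pi; apply: f_supp.
(* The canonical representative [repr h] may have a larger support; [s (F h)] lies in the same class
   because [f] takes the same value on both. *)
exists (Cycle (s_is_cycle (F h))); split; first exact: s_supp.
by rewrite -[h in RHS]reprK; apply/pi_eq; rewrite /= sK.
Qed.

End HomologySuppIso.

(** * Coordinates on A, and the maps m and 2x in them *)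

Section FrobeniusCoordinates.

Variables (R : comNzRingType) (a : R).
Implicit Types (c : R) (u v : frobA a).

Definition frob_pair c0 c1 : frobA a := c0 *: 1 + c1 *: 'qX.

Lemma frob_pair0 c0 c1 : (frob_pair c0 c1)`_0 = c0.
Proof. by rewrite !frobA_coefE mulr1 mulr0 addr0. Qed.

Lemma frob_pair1 c0 c1 : (frob_pair c0 c1)`_1 = c1.
Proof. by rewrite !frobA_coefE mulr1 mulr0 add0r. Qed.

Lemma frob_pairE u : u = frob_pair u`_0 u`_1.
Proof.
by rewrite [LHS]frobA_basis !big_ord_recl big_ord0 addr0 expr0 expr1.
Qed.

Lemma frob_ext u v : u`_0 = v`_0 -> u`_1 = v`_1 -> u = v.
Proof. by move=> e0 e1; rewrite [u]frob_pairE [v]frob_pairE e0 e1. Qed.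

Lemma frobA_coef0 i : (0 : frobA a)`_i = 0.
Proof. exact: coef0. Qed.

Lemma frobA_coefB u v i : (u - v)`_i = u`_i - v`_i.
Proof. exact: coefB. Qed.

Lemma double_dot_pair c0 c1 :
  2 * 'qX * frob_pair c0 c1 = frob_pair (2 * a * c1) (2 * c0).
Proof.
rewrite -mulrA /frob_pair mulrDr -!scalerAr mulr1 qX_sqr scalerA.
rewrite -[2 * a * c1]mulrA !mulr_natl mulrnDl !scalerMnl [c1 * _]mulrC.
exact: addrC.
Qed.

Lemma mergeA_pair (M : tensA R) :
  Defs.mergeA a M =
    frob_pair (M ord0 ord0 + a * M ord_max ord_max)
              (M ord0 ord_max + M ord_max ord0).
Proof.
have e1 : lift ord0 (ord0 : 'I_1) = ord_max by apply/val_inj.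
rewrite /Defs.mergeA !big_ord_recl !big_ord0 !addr0 !e1 /= expr0 expr1 mulr1 mul1r.
rewrite mulr1 qX_sqr /frob_pair !scalerDl scalerA [a * _]mulrC.
by rewrite -!addrA; congr (_ + _); rewrite addrA addrC.
Qed.

(** The shift is 2n+1 in homological degree n+1, so the generators 1 and x, of degrees +1 and -1,
    land in degrees 2n+2 and 2n. *)
Lemma supported_chainS n P u :
  supported (tr_P2_chain a n.+1) P u <->
    (u`_0 != 0 -> P (2 * n.+1%:Z)) /\ (u`_1 != 0 -> P (2 * n%:Z)).
Proof.
have d0 : deg 0 + P2_shift n.+1 = 2 * n.+1%:Z by rewrite /deg /=; lia.
have d1 : deg 1 + P2_shift n.+1 = 2 * n%:Z by rewrite /deg /=; lia.
split=> [uP|[u0 u1]].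
  by rewrite -d0 -d1; split; [apply: (uP ord0) | apply: (uP ord_max)].
move=> -[[|[|//]] lti] /=; rewrite ?d0 ?d1 //.
Qed.

End FrobeniusCoordinates.

(** * Homology of the trace over a general coefficient ring *)

Section TraceHomology.

Variables (R : comUnitRingType) (a : R) (S : pred int -> Prop).
Local Notation H := (homology (tr_P2 a)).

(** The kernel of m is free on x (x) x - a (1 (x) 1), of leading degree -2, and 1 (x) x - x (x) 1,
    of degree 0. The coefficients of x (x) x and 1 (x) x are coordinates on it. *)
Lemma homology0 : supp_iso (admissible a) (H 0) (qsum (qat (- 2) R) (qat 0 R)).
Proof.
pose f (M : tensA R) : R * R := (M ord_max ord_max, M ord0 ord_max).
pose s (g : R * R) : tensA R := \matrix_(i, j)
  if i == ord0 then (if j == ord0 then - (a * g.1) else g.2)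
  else (if j == ord0 then - g.2 else g.1).
apply: (@homology_supp_iso (tr_P2 a) 0 (qsum (qat (- 2) R) (qat 0 R)) _ f s).
- by move=> M N; rewrite /f !mxE.
- move=> g; rewrite [LHS](mergeA_pair a (s g)) !mxE /= addNr subrr.
  by rewrite /frob_pair !scale0r addr0.
- by case=> g1 g2; rewrite /f !mxE.
- move=> M dM; have {dM} : Defs.mergeA a M = 0 by exact: dM.
  rewrite mergeA_pair => dM; split=> [[M11 M01]|/eqP ->]; last by rewrite /f !mxE.
  have := congr1 (fun u : frobA a => u`_0) dM.
  have := congr1 (fun u : frobA a => u`_1) dM.
  rewrite frob_pair0 frob_pair1 !frobA_coef0 M11 M01 mulr0 addr0 add0r => M10 M00.
  apply/eqP/matrixP => -[[|[|//]] i] -[[|[|//]] j]; rewrite mxE.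
  + by rewrite -[RHS]M00; congr (M _ _); apply: val_inj.
  + by rewrite -[RHS]M01; congr (M _ _); apply: val_inj.
  + by rewrite -[RHS]M10; congr (M _ _); apply: val_inj.
  + by rewrite -[RHS]M11; congr (M _ _); apply: val_inj.
- by move=> P M _ _ MP; split; [apply: (MP ord_max ord_max)|apply: (MP ord0 ord_max)].
- move=> P g Pa [/= g1P g2P] i j; rewrite addr0 /s !mxE.
  case: i j => [[|[|//]] i] [[|[|//]] j] /=; rewrite ?oppr_eq0; try by [].
  (* The remaining entry is that of 1 (x) 1, in degree 2. It can be nonzero only when [a] is, and
     then [P] is up-closed and contains 2 along with -2. *)
  move=> ag1.
  have a0 : a <> 0 by move=> a0; rewrite a0 mul0r eqxx in ag1.
  apply: (implyP (Pa a0 (- 2) _ _)) => //; apply: g1P.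
  by apply: contraNneq ag1 => ->; rewrite mulr0.
Qed.

Lemma homology1 : supp_iso S (H 1) qzero.
Proof.
apply: (@homology_supp_iso (tr_P2 a) 1 qzero _ (fun=> 0) (fun=> 0)) => //.
- by move=> ? ?; rewrite subr0.
- by move=> g; rewrite raddf0.
- by move=> g; apply/rowP => -[].
- move=> z _; split=> // _; apply/asboolP.
  (* The preimage is 1 (x) z, whose product is z. *)
  exists (\matrix_(i, j) if i == ord0 then (z : frobA a)`_j else 0).
  rewrite [LHS](mergeA_pair a) !mxE /= mulr0 !addr0.
  by rewrite -frob_pairE.
- move=> P g _ _; apply/supported_chainS.
  by rewrite !frobA_coef0 eqxx.
Qed.

(** * Kernel and cokernel of 2x, in degrees [n.+1] = 2k and [n.+2] = 2k+1 *)

Section Even.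

Variable n : nat.
Hypothesis n_even : ~~ odd n.+1.

Lemma tr_P2_diffS u :
  tr_P2_diff a n.+1 u = frob_pair a (2 * a * u`_1) (2 * u`_0).
Proof. by rewrite tr_P2_diff_even // {1}[u]frob_pairE double_dot_pair. Qed.

(** The incoming differential has odd index [n], so it is the difference of two equal dot maps.
    Parity also excludes [n = 0], where it would be m. *)
Lemma boundary_even (u : chain (tr_P2 a) n.+1) : is_boundary_val u <-> u = 0.
Proof.
have n_odd : odd n by rewrite -[odd n]negbK -oddS.
case: n n_odd u => [//|m] m_odd u; split=> [/asboolP [b <-]|->].
  exact: (tr_P2_diff_odd b m_odd).
by apply/asboolP; exists 0; rewrite raddf0.
Qed.

(** For a = 0, 2x sends c0 + c1 x to 2 c0 x; regularity of 2 leaves exactly the multiples of x as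
    cycles. *)
Lemma homology_even :
  GRing.lreg (2 : R) -> a = 0 -> supp_iso S (H n.+1) (qat (2 * n%:Z) R).
Proof.
move=> reg2 a0; apply: (@homology_supp_iso (tr_P2 a) n.+1 (qat _ R) _
  (fun u : frobA a => u`_1) (frob_pair a 0)).
- by move=> u v; rewrite frobA_coefB.
- move=> g; rewrite [LHS]tr_P2_diffS a0 mulr0 mul0r frob_pair0 mulr0.
  by rewrite /frob_pair !scale0r addr0.
- by move=> g; rewrite frob_pair1.
- move=> z dz; rewrite boundary_even; split=> [z1|->]; last exact: frobA_coef0.
  have : tr_P2_diff a n.+1 z = 0 by exact: dz.
  rewrite tr_P2_diffS => /(congr1 (fun u : frobA a => u`_1)).
  rewrite frob_pair1 frobA_coef0 => /eqP; rewrite mulrI_eq0 // => /eqP z0.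
  by apply: frob_ext; rewrite frobA_coef0.
- by move=> P z _ _ /supported_chainS [].
- move=> P g _ gP; apply/supported_chainS.
  by rewrite frob_pair0 frob_pair1 eqxx.
Qed.

Lemma homology_even_acyclic :
  GRing.lreg (2 : R) -> GRing.lreg a -> supp_iso S (H n.+1) qzero.
Proof.
move=> reg2 rega.
apply: (@homology_supp_iso (tr_P2 a) n.+1 qzero _ (fun=> 0) (fun=> 0)) => //.
- by move=> ? ?; rewrite subr0.
- by move=> g; rewrite raddf0.
- by move=> g; apply/rowP => -[].
- move=> z dz; split=> // _; apply/boundary_even.
  have : tr_P2_diff a n.+1 z = 0 by exact: dz.
  rewrite tr_P2_diffS => e.
  have := congr1 (fun u : frobA a => u`_0) e.
  have := congr1 (fun u : frobA a => u`_1) e.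
  rewrite frob_pair0 frob_pair1 !frobA_coef0 -mulrA.
  move=> /eqP; rewrite mulrI_eq0 // => /eqP z0.
  move=> /eqP; rewrite !mulrI_eq0 // => /eqP z1.
  by apply: frob_ext; rewrite frobA_coef0.
- move=> P g _ _; apply/supported_chainS.
  by rewrite !frobA_coef0 eqxx.
Qed.

Lemma diff_odd u : tr_P2_diff a n.+2 u = 0.
Proof. by apply: tr_P2_diff_odd; rewrite oddS n_even. Qed.

Lemma boundary_odd (u : chain (tr_P2 a) n.+2) :
  is_boundary_val u <->
    exists b : R * R, (u : frobA a)`_0 = 2 * a * b.1 /\ (u : frobA a)`_1 = 2 * b.2.
Proof.
split=> [/asboolP [v <-]|[[b0 b1] [/= u0 u1]]].
  (* The coordinates are exchanged because multiplication by x swaps the lines of 1 and x. *)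
  exists ((v : frobA a)`_1, (v : frobA a)`_0).
  by rewrite tr_P2_diffS frob_pair0 frob_pair1.
apply/asboolP; exists (frob_pair a b1 b0); rewrite [LHS]tr_P2_diffS.
by rewrite frob_pair0 frob_pair1 -u0 -u1 -frob_pairE.
Qed.

(** The cokernel of 2x is R/2a on 1 plus R/2 on x. The maps [p] and [q] stand for the two quotient
    maps, which lets [p] be the identity when a = 0. Their sections [p'] and [q'] must fix 0 so that
    they do not enlarge supports. *)
Lemma homology_odd (M N : zmodType) (p : {additive R -> M}) (q : {additive R -> N})
    (p' : M -> R) (q' : N -> R) :
    cancel p' p -> cancel q' q -> p' 0 = 0 -> q' 0 = 0 ->
    (forall c, p c = 0 <-> exists b, c = 2 * a * b) ->
    (forall c, q c = 0 <-> exists b, c = 2 * b) ->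
  supp_iso S (H n.+2) (qsum (qat (2 * n.+2%:Z) M) (qat (2 * n.+1%:Z) N)).
Proof.
move=> p'K q'K p'0 q'0 kerp kerq.
apply: (@homology_supp_iso (tr_P2 a) n.+2 (qsum (qat _ M) (qat _ N)) _
  (fun u : frobA a => (p u`_0, q u`_1)) (fun g => frob_pair a (p' g.1) (q' g.2))).
- by move=> u v; rewrite !frobA_coefB !raddfB.
- by move=> g; apply: diff_odd.
- by case=> g h; rewrite frob_pair0 frob_pair1 p'K q'K.
- move=> z _; rewrite boundary_odd; split=> [[/kerp [b0 e0] /kerq [b1 e1]]|[b [e0 e1]]].
    by exists (b0, b1).
  by congr (_, _); [apply/kerp; exists b.1|apply/kerq; exists b.2].
- move=> P z _ _ /supported_chainS [z0P z1P]; split=> /= nz.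
    by apply: z0P; apply: contraNneq nz => ->; rewrite raddf0.
  by apply: z1P; apply: contraNneq nz => ->; rewrite raddf0.
- move=> P g _ [gP hP]; apply/supported_chainS.
  rewrite frob_pair0 frob_pair1; split=> nz; [apply: gP|apply: hP].
    by apply: contraNneq nz => ->; rewrite p'0.
  by apply: contraNneq nz => ->; rewrite q'0.
Qed.

(** With a = 0 the image of 2x is 2R x, which is all of R x once 2 is invertible, so only the line
    of 1 survives. *)
Lemma homology_odd_unit :
  a = 0 -> 2 \is a @GRing.unit R -> supp_iso S (H n.+2) (qat (2 * n.+2%:Z) R).
Proof.
move=> a0 u2.
apply: (@homology_supp_iso (tr_P2 a) n.+2 (qat _ R) _
  (fun u : frobA a => u`_0) (fun g => frob_pair a g 0)).
- by move=> u v; rewrite !frobA_coefB.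
- by move=> g; apply: diff_odd.
- by move=> g; rewrite frob_pair0.
- move=> z _; rewrite boundary_odd; split=> [z0|[b [-> _]]].
    exists (0, 2^-1 * (z : frobA a)`_1).
    by rewrite /= mulr0 mulrA mulrV // mul1r.
  by rewrite a0 mulr0 mul0r.
- by move=> P z _ _ /supported_chainS [].
- move=> P g _ gP; apply/supported_chainS.
  by rewrite frob_pair0 frob_pair1 eqxx.
Qed.

End Even.

End TraceHomology.

(** * Cyclic groups as quotients of the integers *)

Section CyclicGroups.

Variable m : int.

Definition intr_Zmod (c : int) : Zmod m := c%:~R.

Fact intr_Zmod_zmod_morphism : zmod_morphism intr_Zmod.
Proof. exact: intrB. Qed.
HB.instance Definition _ :=
  GRing.isZmodMorphism.Build int (Zmod m) intr_Zmod intr_Zmod_zmod_morphism.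

(** The least nonnegative residue, a set-theoretic section of reduction that fixes 0, as
    [homology_odd] asks. *)
Definition Zmod_val (x : Zmod m) : int := Posz (x : 'Z_`|m|).

Lemma Zmod_valK : cancel Zmod_val intr_Zmod.
Proof. exact: natr_Zp. Qed.

Lemma intr_Zmod_eq0 (c : int) :
  (1 < `|m|)%N -> intr_Zmod c = 0 <-> exists b, c = m * b.
Proof.
move=> m_gt1; have m0 : (`|m|%:R : 'Z_`|m|) = 0 by exact: pchar_Zp.
have {}m0 : (m%:~R : 'Z_`|m|) = 0.
  by rewrite [m in m%:~R]intEsign intrM -[X in _ * X]/(`|m|%:R) m0 mulr0.
rewrite /intr_Zmod; split=> [c0|[b ->]]; last by rewrite intrM m0 mul0r.
suff /dvdzP [b ->] : (m %| c)%Z by exists b; rewrite mulrC.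
(* Passing to absolute values changes [c] only by a sign and allows the residue to be computed in
   the natural numbers. *)
have {}c0 : (`|c|%:R : 'Z_`|m|) = 0.
  by rewrite -[_%:R]/(`|c|%N%:~R) abszEsign intrM c0 mulr0.
have := congr1 (fun x : 'Z_`|m| => x : nat) c0.
by rewrite val_Zp_nat //= => /eqP; rewrite /dvdz.
Qed.

End CyclicGroups.

Theorem mainTheorem8 :
  (forall alpha : int,
     let H := homology (tr_P2 alpha) in
     [/\ qiso alpha (H 0%N) (qsum (qat (- 2) int) (qat 0 int)),
         qiso alpha (H 1%N) qzero
       & forall k : nat, (0 < k)%N ->
           qiso alpha (H (2 * k)%N)
             (if alpha == 0 then qat (4 * k%:Z - 2) int else qzero) /\
           qiso alpha (H (2 * k).+1)
             (if alpha == 0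
              then qsum (qat (4 * k%:Z + 2) int) (qat (4 * k%:Z) (Zmod 2))
              else qsum (qat (4 * k%:Z + 2) (Zmod (2 * alpha)))
                        (qat (4 * k%:Z) (Zmod 2)))])
  /\
  (let H := homology (tr_P2 (0 : rat)) in
   [/\ graded_iso (H 0%N) (qsum (qat (- 2) rat) (qat 0 rat)),
       graded_iso (H 1%N) qzero
     & forall k : nat, (0 < k)%N ->
         graded_iso (H (2 * k)%N) (qat (4 * k%:Z - 2) rat) /\
         graded_iso (H (2 * k).+1) (qat (4 * k%:Z + 2) rat)]).
Proof.
have index (k : nat) : (0 < k)%N -> exists n : nat,
    [/\ (2 * k)%N = n.+1, ~~ odd n.+1, 4 * k%:Z - 2 = 2 * n%:Z,
        4 * k%:Z = 2 * n.+1%:Z & 4 * k%:Z + 2 = 2 * n.+2%:Z].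
  (* Here [k] has become the predecessor, so the witness is [n] = 2k-1 in terms of the original
     [k]. *)
  by case: k => // k _; exists (2 * k).+1; split; lia.
have reg2 : GRing.lreg (2 : int) by exact: mulfI.
split=> [alpha H|H].
  split; [apply/supp_iso_qiso/homology0|apply/supp_iso_qiso/homology1|].
  move=> k /index [n [-> n_even -> -> ->]].
  have ker2 c : intr_Zmod 2 c = 0 <-> exists b, c = 2 * b.
    exact: intr_Zmod_eq0.
  split; case: eqP => [alpha0|/eqP alpha0]; apply: supp_iso_qiso.
  - exact: homology_even.
  - by apply: homology_even_acyclic => //; apply: mulfI.
  (* For alpha = 0 the summand R/2a is Z itself, with the identity as quotient map. *)
  - apply: (@homology_odd _ alpha _ _ n_even int (Zmod 2) idfun (intr_Zmod 2) id
      (@Zmod_val 2)) => //; first exact: Zmod_valK.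
    move=> c; split=> [/= ->|[b ->]]; last by rewrite alpha0 mulr0 mul0r.
    by exists 0; rewrite mulr0.
  - apply: (@homology_odd _ alpha _ _ n_even (Zmod (2 * alpha)) (Zmod 2)
      (intr_Zmod (2 * alpha)) (intr_Zmod 2)
      (@Zmod_val (2 * alpha)) (@Zmod_val 2)) => //; try exact: Zmod_valK.
    (* Since alpha is nonzero, the modulus 2 alpha has absolute value at least 2, so [Zmod] denotes
       the intended group. *)
    by move=> c; apply: intr_Zmod_eq0; rewrite abszM; lia.
split; [apply/supp_iso_graded/homology0|apply/(@supp_iso_graded rat)/homology1|].
move=> k /index [n [-> n_even -> _ ->]].
split; apply: (@supp_iso_graded rat); first by apply: homology_even => //; apply: mulfI.
exact: homology_odd_unit.
Qed.
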